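(* The supernorm map $\widehat{N}:\mathcal{P}\to\mathbb{N}$ is an isomorphism between the monoid $(\mathcal{P},\cdot)$ of integer partitions under partition multiplication and the monoid $(\mathbb{N},\cdot)$ of positive integers under integer multiplication.
   Context: $\mathbb{N}$ denotes the set of positive integers. $\mathcal{P}$ is the set of all integer partitions, i.e. finite multisets $\lambda=(\lambda_1,\dots,\lambda_r)$ of positive integers with $\lambda_1\ge\dots\ge\lambda_r\ge1$, including the empty partition $\emptyset$. Partition multiplication $\lambda\cdot\lambda'$ is the multiset union (concatenation) of the parts of $\lambda$ and $\lambda'$; for example $(3,1,1)\cdot(4,3,2)=(4,3,3,2,1,1)$. Its identity is $\emptyset$. With $p_i$ the $i$th prime ($p_1=2,p_2=3,\dots$), the supernorm is $\widehat{N}(\lambda):=p_{\lambda_1}p_{\lambda_2}\cdots p_{\lambda_r}$, with $\widehat{N}(\emptyset):=1$. *)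

(* Defs.v *)
From HB Require Import structures.
From mathcomp Require Import all_boot.

Set Implicit Arguments.
Unset Strict Implicit.
Unset Printing Implicit Defensive.

(* A partition is encoded by the weakly decreasing sequence of its parts. *)
Record intpart := IntPart {
  parts :> seq nat;
  _ : sorted geq parts && all (leq 1) parts }.

HB.instance Definition _ := [isSub for parts].
HB.instance Definition _ := [Choice of intpart by <:].

Lemma parts_gt0 (la : intpart) i : i \in parts la -> 0 < i.
Proof. by case: la => s /= /andP[_ /allP h] /h. Qed.

Definition intpart0 : intpart := @IntPart [::] isT.

Lemma geq_total : total geq.
Proof. by move=> m n; apply: leq_total. Qed.

Lemma geq_trans : transitive geq.
Proof. by move=> n m p /= mn np; apply: leq_trans np mn. Qed.

Lemma geq_anti : antisymmetric geq.
Proof. by move=> m n; rewrite /geq /= andbC => /anti_leq. Qed.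

Fact intpart_mul_subproof (la mu : intpart) :
  let s := sort geq (parts la ++ parts mu) in sorted geq s && all (leq 1) s.
Proof.
rewrite /= (sort_sorted geq_total) all_sort all_cat.
by case: la mu => [s /= /andP[_ ->]] [t /= /andP[_ ->]].
Qed.

Definition intpart_mul (la mu : intpart) : intpart :=
  IntPart (intpart_mul_subproof la mu).

Lemma intpart_eqP (la mu : intpart) : perm_eq la mu -> la = mu.
Proof.
move=> h; apply/val_inj/(sorted_eq geq_trans geq_anti) => //.
  by case: la {h} => s /= /andP[].
by case: mu {h} => s /= /andP[].
Qed.

Fact intpart_mulA : associative intpart_mul.
Proof.
move=> a b c; apply: intpart_eqP => /=; rewrite perm_sort perm_sym perm_sort.
apply: (@perm_trans _ ((parts a ++ parts b) ++ parts c)).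
  by rewrite perm_cat2r perm_sort.
by rewrite -catA perm_cat2l perm_sym perm_sort.
Qed.

Fact intpart_mul0l : left_id intpart0 intpart_mul.
Proof. by move=> a; apply: intpart_eqP; rewrite /= perm_sort. Qed.

Fact intpart_mul0r : right_id intpart0 intpart_mul.
Proof. by move=> a; apply: intpart_eqP; rewrite /= cats0 perm_sort. Qed.

HB.instance Definition _ :=
  isMonoid.Build intpart intpart_mulA intpart_mul0l intpart_mul0r.

Record posnat := PosNat { nat_of_pos :> nat; _ : 0 < nat_of_pos }.

HB.instance Definition _ := [isSub for nat_of_pos].
HB.instance Definition _ := [Choice of posnat by <:].

Lemma posnat_gt0 (m : posnat) : 0 < m.
Proof. by case: m. Qed.

Fact posnat_mul_subproof (m n : posnat) : 0 < (m : nat) * n.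
Proof. by rewrite muln_gt0 !posnat_gt0. Qed.

Definition posnat1 : posnat := @PosNat 1 isT.

Definition posnat_mul (m n : posnat) : posnat :=
  PosNat (posnat_mul_subproof m n).

Fact posnat_mulA : associative posnat_mul.
Proof. by move=> m n p; apply: val_inj; rewrite /= mulnA. Qed.

Fact posnat_mul1l : left_id posnat1 posnat_mul.
Proof. by move=> m; apply: val_inj; rewrite /= mul1n. Qed.

Fact posnat_mul1r : right_id posnat1 posnat_mul.
Proof. by move=> m; apply: val_inj; rewrite /= muln1. Qed.

HB.instance Definition _ :=
  isMonoid.Build posnat posnat_mulA posnat_mul1l posnat_mul1r.

Fact next_prime_subproof (n : nat) : exists p, prime p && (n < p).
Proof. by case: (prime_above n) => p np pp; exists p; rewrite pp. Qed.

Definition next_prime (n : nat) : nat := ex_minn (next_prime_subproof n).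

(* Indices start at 1: nth_prime 1 = 2, nth_prime 2 = 3; the value
   nth_prime 0 = 0 is junk and is never reached, since parts are positive. *)
Definition nth_prime (i : nat) : nat := iter i next_prime 0.

Lemma nth_prime_gt0 i : 0 < i -> 0 < nth_prime i.
Proof.
case: i => // i _; rewrite /nth_prime /= /next_prime.
by case: ex_minnP => p /andP[/prime_gt0].
Qed.

Fact supernorm_subproof (la : intpart) : 0 < \prod_(i <- parts la) nth_prime i.
Proof.
rewrite big_seq; apply: prodn_cond_gt0 => i /parts_gt0.
exact: nth_prime_gt0.
Qed.

Definition supernorm (la : intpart) : posnat := PosNat (supernorm_subproof la).

(* Main.v *)
Require Import Defs.
From mathcomp Require Import all_boot.

Set Implicit Arguments.
Unset Strict Implicit.
Unset Printing Implicit Defensive.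

(* Listing the primes by repeatedly taking the next one reaches every prime
   exactly once.  Existence of prime factorizations then gives surjectivity, and
   injectivity holds because the multiplicity of the part [i] is recovered as
   the [p_i]-adic valuation of the supernorm. *)

Lemma nth_prime_prime i : 0 < i -> prime (nth_prime i).
Proof.
by case: i => // i _; rewrite /nth_prime /= /next_prime; case: ex_minnP => p /andP[].
Qed.

Lemma nth_prime_ltS i : nth_prime i < nth_prime i.+1.
Proof.
by rewrite /nth_prime /= {2}/next_prime; case: ex_minnP => p /andP[].
Qed.

Lemma nth_prime_lt : {homo nth_prime : i j / i < j}.
Proof. exact/(homo_ltn ltn_trans)/nth_prime_ltS. Qed.

Lemma nth_prime_inj : injective nth_prime.
Proof.
by move=> i j eq_ij; case: (ltngtP i j) => // /nth_prime_lt; rewrite eq_ij ltnn.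
Qed.

Lemma leq_nth_prime i : i <= nth_prime i.
Proof. by elim: i => // i IHi; apply: leq_ltn_trans IHi (nth_prime_ltS i). Qed.

Lemma nth_primeS_min i p : prime p -> nth_prime i < p -> nth_prime i.+1 <= p.
Proof.
move=> p_pr lt_ip; rewrite /nth_prime /= /next_prime.
by case: ex_minnP => q _; apply; rewrite p_pr.
Qed.

(** Some index bounds [p], as [p <= nth_prime p]. At the least such index the previous value is
    below [p], so minimality of the next prime forces equality. *)
Lemma prime_nth_prime p : prime p -> exists2 i, 0 < i & nth_prime i = p.
Proof.
(* Only the index varies in the induction; [nth_prime 0 = 0] bounds no prime. *)
move=> p_pr; have := leq_nth_prime p; elim: {2}p => [|n IHn] le_pn.
  by move: le_pn p_pr; rewrite leqn0 => /eqP->.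
have [/IHn //|lt_np] := leqP p (nth_prime n).
by exists n.+1 => //; apply/eqP; rewrite eqn_leq le_pn nth_primeS_min.
Qed.

(** By injectivity of [nth_prime], a factor has valuation 1 if its index is [i] and 0 otherwise.
    Positive entries keep the junk value 0 out of the product. *)
Lemma logn_nth_prime_prod i (s : seq nat) : 0 < i -> all (leq 1) s ->
  logn (nth_prime i) (\prod_(j <- s) nth_prime j) = count_mem i s.
Proof.
move=> i_gt0; elim: s => [|j s IHs] /=; first by rewrite big_nil logn1.
case/andP=> j_gt0 s_gt0; rewrite big_cons lognM ?nth_prime_gt0 //; last first.
  rewrite big_seq; apply: prodn_cond_gt0 => k /(allP s_gt0).
  exact: nth_prime_gt0.
by rewrite logn_prime ?nth_prime_prime // (inj_eq nth_prime_inj) IHs // eq_sym.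
Qed.

Lemma nth_prime_factorization m : 0 < m ->
  exists2 s, all (leq 1) s & \prod_(i <- s) nth_prime i = m.
Proof.
elim/ltn_ind: m => m IHm m_gt0; have [m_gt1|m_le1] := ltnP 1 m; last first.
  by exists [::]; rewrite // big_nil; apply/eqP; rewrite eqn_leq m_gt0.
have p_pr := pdiv_prime m_gt1; have [i i_gt0 def_p] := prime_nth_prime p_pr.
(* Split off the least prime factor and factor the quotient. *)
have [||s s_gt0 def_s] := IHm (m %/ pdiv m).
- by rewrite ltn_Pdiv ?prime_gt1.
- by rewrite divn_gt0 ?pdiv_gt0 // pdiv_leq.
exists (i :: s); first by rewrite /= i_gt0.
by rewrite big_cons def_s def_p mulnC divnK ?pdiv_dvd.
Qed.

Lemma supernorm_inj : injective supernorm.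
Proof.
move=> la mu /(congr1 val) /= eq_N; apply: intpart_eqP; apply/allP => i _ /=.
have gt0 (nu : intpart) : all (leq 1) nu by apply/allP => j /parts_gt0.
(* Valuations recover the counts of positive [i] only; 0 is never a part. *)
have [->|i_gt0] := posnP i; last by rewrite -!logn_nth_prime_prod ?gt0 ?eq_N.
have no0 (nu : intpart) : count_mem 0 nu = 0.
  by apply/count_memPn/negP => /parts_gt0.
by rewrite !no0.
Qed.

(** Boolean equality lets [xchoose] extract a preimage. *)
Lemma supernorm_surj m : exists la, supernorm la == m.
Proof.
have [s s_gt0 def_m] := nth_prime_factorization (posnat_gt0 m).
have sP : sorted geq (sort geq s) && all (leq 1) (sort geq s).
  by rewrite (sort_sorted geq_total) all_sort.
exists (IntPart sP); apply/eqP/val_inj; rewrite /= -def_m.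
by apply: perm_big; rewrite perm_sort.
Qed.

Lemma supernormM : {morph supernorm : la mu / intpart_mul la mu >-> posnat_mul la mu}.
Proof.
move=> la mu; apply: val_inj; rewrite /= -big_cat.
by apply: perm_big; rewrite perm_sort.
Qed.

Theorem proposition1p1 :
  monoid_morphism supernorm /\ bijective supernorm.
Proof.
split; first by split; [apply: val_inj; rewrite /= big_nil | apply: supernormM].
have supernormK m : supernorm (xchoose (supernorm_surj m)) = m.
  exact/eqP/(xchooseP (supernorm_surj m)).
(* By injectivity, this right inverse is also a left inverse. *)
exists (fun m => xchoose (supernorm_surj m)) => // la.
exact/supernorm_inj/supernormK.
Qed.
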